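(* Let $L>0$ be any integer, and let $\widehat B_k^{\mathrm u}=B^{\mathrm u}(\widehat n_k,\underline{\widehat w}^{(k)})$ $(k=1,2,\dots)$ be sub-bridges of $\bar B_k^{\mathrm u}=B^{\mathrm u}(n_0+k+Lk,\underline w^{(k+Lk)})$ satisfying properties (1) and (2) in the context, and let $\widehat J_{k+1}^{\mathrm{cs}}$ be the cs-interval associated with $\widehat B_{k+1}^{\mathrm u}$. Then for each $k$ there exists $t_{k+1}\in\mathbb R$ such that - $\varphi^{\widehat n_k}(\widehat x_k^{\mathrm u},1/2)=(1/2,\widehat z_{k+1}^{\mathrm{cs}})-(0,a_2^{-1}t_{k+1})$, where $\widehat x_k^{\mathrm u}$ and $\widehat z_{k+1}^{\mathrm{cs}}$ are the centres of $\widehat B_k^{\mathrm u}$ and $\widehat J_{k+1}^{\mathrm{cs}}$, respectively; - $|t_{k+1}|<\lambda_u^{-(n_0+k+1+L(k+1))}$.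
   Context: Constants: $\lambda_{ss},\lambda_{cs0},\lambda_{cs1},\lambda_u>0$ with $\lambda_{ss}<\lambda_{cs0}<1/2<\lambda_{cs1}<1<\lambda_{cs0}+\lambda_{cs1}$, $2<\lambda_u$, $\lambda_{cs0}\lambda_{cs1}\lambda_u^2<1$; $\beta=1-\lambda_{cs1}$; $a_2>0$. On $[0,1]$ let $\zeta_0(z)=\lambda_{cs0}z$, $\zeta_1(z)=\lambda_{cs1}z+\beta$. With $V_0=[0,\lambda_u^{-1}]$, $V_1=[1-\lambda_u^{-1},1]$, the blender-horseshoe map $f$ is given on points of $[0,1]^3$ by $f(x,y,z)=(\lambda_ux,\lambda_{ss}y,\zeta_0(z))$ for $x\in V_0$ and $f(x,y,z)=(\lambda_u(1-x),1-\lambda_{ss}y,\zeta_1(z))$ for $x\in V_1$. Set $\varphi^n(x,z)=\widehat\pi(f^n(x,y,z))$, $\widehat\pi(x,y,z)=(x,z)$ (whenever this does not depend on $y$). A code is a finite word in $\{0,1\}$; $|\cdot|$ is its length. For $\underline\gamma=\gamma_1\cdots\gamma_n$ put $\boldsymbol\zeta_{\underline\gamma}=\zeta_{\gamma_n}\circ\cdots\circ\zeta_{\gamma_1}$. For $\underline w=w_1\cdots w_n$ the u-bridge $B^{\mathrm u}(n,\underline w)\subset[0,1]$ is the closed interval of $x$ such that the $x$-coordinate of $f^{i-1}(x,0,0)$ lies in $V_{w_i}$ for $i=1,\dots,n$. A sub-bridge of a u-bridge is a u-bridge contained in it. The maximal sub-bridges of $B^{\mathrm u}(\underline w)$ are $B^{\mathrm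 u}(\underline w0),B^{\mathrm u}(\underline w1)$. Fix $n_0\ge0$ and $\underline{\widetilde w}^{(0)}\in\{0,1\}^{n_0}$ with $\widetilde B_0^{\mathrm u}=B^{\mathrm u}(n_0,\underline{\widetilde w}^{(0)})\subset(0,a_2)$. For $k\ge1$ let $B_k^{\mathrm u}=B^{\mathrm u}(n_0+k,\underline w^{(k)})$ and $\widetilde B_k^{\mathrm u}$ be the two maximal sub-bridges of $\widetilde B_{k-1}^{\mathrm u}$, with $\widetilde B_k^{\mathrm u}$ to the left of $B_k^{\mathrm u}$. The cs-interval associated with a u-bridge $B\subset\widetilde B_0^{\mathrm u}$ is $J=a_2^{-1}B$. For each $k\ge1$, $\bar B_k^{\mathrm u}=B^{\mathrm u}(n_0+k+Lk,\underline w^{(k+Lk)})\subset B_k^{\mathrm u}$ is a u-bridge (so $\underline w^{(k+Lk)}$ is a code of length $n_0+k+Lk$ extending $\underline w^{(k)}$), with cs-interval $\bar J_k^{\mathrm{cs}}$, and $\underline u^{(k)}$ is a code. Properties: (1) $\underline{\widehat w}^{(k)}=\underline w^{(k+Lk)}\underline v^{(k)}\underline\gamma^{(k)}$, with $|\underline\gamma^{(k)}|=m_k$, $0<m_k\le N_0+N_1k$ for positive integers $N_0,N_1$ independent of $k$, and $\underline v^{(k)}$ equal to $\underline u^{(k)}$ or $\underline u^{(k)}\alpha$ for some $\alpha\in\{0,1\}$; $\widehat n_k=|\underline{\widehat w}^{(k)}|$. (2) $\boldsymbol\zeta_{\underline{\widehat w}^{(k)}}(1/2)\in\bar J_{k+1}^{\mathrm{cs}}$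 and $\widehat J_{k+1}^{\mathrm{cs}}\subset\bar J_{k+1}^{\mathrm{cs}}$. *)

(* Defs.v *)
From mathcomp Require Import all_boot all_order all_algebra.
From mathcomp Require Import all_classical all_reals.

Set Implicit Arguments.
Unset Strict Implicit.
Unset Printing Implicit Defensive.

Import Order.TTheory GRing.Theory Num.Theory.
Local Open Scope classical_set_scope.
Local Open Scope ring_scope.

(* A code is a word w : seq bool, with false for the letter 0 and true for the
   letter 1. *)

Definition blender_constants (R : realType) (lss lcs0 lcs1 lu : R) : Prop :=
  [/\ [/\ 0 < lss, 0 < lcs0, 0 < lcs1 & 0 < lu],
      [/\ lss < lcs0, lcs0 < 1 / 2, 1 / 2 < lcs1, lcs1 < 1 & 1 < lcs0 + lcs1],
      2 < lu &
      lcs0 * lcs1 * lu ^+ 2 < 1].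

Definition zeta (R : realType) (lcs0 lcs1 : R) (g : bool) (z : R) : R :=
  if g then lcs1 * z + (1 - lcs1) else lcs0 * z.

(* zeta_{g_n} o ... o zeta_{g_1}: the first letter acts first. *)
Definition zeta_word (R : realType) (lcs0 lcs1 : R) (w : seq bool) (z : R) : R :=
  foldl (fun z' g => zeta lcs0 lcs1 g z') z w.

Definition V (R : realType) (lu : R) (g : bool) : set R :=
  if g then `[1 - lu^-1, 1]%classic else `[0, lu^-1]%classic.

(* The triple (x, y, z) is ((x, y), z).  Nothing is assumed about f at points
   of [0,1]^3 with x outside V_0 and V_1, nor outside [0,1]^3. *)
Definition blender_horseshoe_map (R : realType) (lss lcs0 lcs1 lu : R)
    (f : R * R * R -> R * R * R) : Prop :=
  forall x y z : R,
    (x \in `[0, 1]) -> (y \in `[0, 1]) -> (z \in `[0, 1]) ->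
    (V lu false x -> f (x, y, z) = (lu * x, lss * y, zeta lcs0 lcs1 false z)) /\
    (V lu true x ->
       f (x, y, z) = (lu * (1 - x), 1 - lss * y, zeta lcs0 lcs1 true z)).

Definition pihat (R : realType) (p : R * R * R) : R * R := (p.1.1, p.2).

(* phi^n(x, z) is defined, i.e. pihat (f^n(x, y, z)) is the same for all y in
   [0,1], and equals q. *)
Definition phi_iter_eq (R : realType) (f : R * R * R -> R * R * R) (n : nat)
    (x z : R) (q : R * R) : Prop :=
  forall y : R, (y \in `[0, 1]) -> pihat (iter n f (x, y, z)) = q.

(* B^u(n, w) with n = size w; letters are numbered from 0, so that nth false w i
   is w_{i+1}. *)
Definition ubridge (R : realType) (lu : R) (f : R * R * R -> R * R * R)
    (w : seq bool) : set R :=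
  [set x | (x \in `[0, 1]) /\
     forall i : nat, (i < size w)%N ->
       V lu (nth false w i) (iter i f (x, 0, 0)).1.1].

Definition cs_interval (R : realType) (a2 : R) (B : set R) : set R :=
  [set a2^-1 * x | x in B].

Definition centre (R : realType) (I : set R) : R := (inf I + sup I) / 2.

Definition left_of (R : realType) (A B : set R) : Prop :=
  forall a b : R, A a -> B b -> a < b.

(* The two maximal sub-bridges of B^u(w) are B^u(w0) and B^u(w1); wl and wr are
   the codes of the left and of the right one. *)
Definition maximal_sub_bridge_codes (R : realType) (lu : R)
    (f : R * R * R -> R * R * R) (w wl wr : seq bool) : Prop :=
  (exists b : bool, wl = rcons w b /\ wr = rcons w (~~ b)) /\
  left_of (ubridge lu f wl) (ubridge lu f wr).

(* Main.v *)
Require Import Defs.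
From mathcomp Require Import all_boot all_order all_algebra.
From mathcomp Require Import all_classical all_reals.
From mathcomp Require Import lra.
Import Order.TTheory GRing.Theory Num.Theory.
Local Open Scope classical_set_scope.
Local Open Scope ring_scope.

(** Forgetting the y-coordinate, the horseshoe map is the skew product of the
    full two-branch expanding map [branch] in x over the contractions [zeta] in
    z.  The u-bridge of a code w consists of the points with x-itinerary w, and
    since every branch is affine onto [0,1] with slope of modulus lu, it is a
    closed interval of length lu^-|w| ([ubridgeE]) whose centre is carried by
    the n = |w| iterates onto the centre 1/2 of [0,1], while the z-coordinate is
    moved by the corresponding composition of the maps zeta
    ([iter_bridge_centre]).

    Hence the first claim only says that t is a2 times the difference between
    the centre of the next cs-interval and zeta_w(1/2).  Rescaled by a2, both
    points lie in the u-bridge of wbar (k+1), whose length is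
    lu^-(n0 + (k+1) + L(k+1)), so |t| is at most that length.  The inequality
    is strict because the first point is the centre of a nondegenerate interval
    contained in that u-bridge, hence an interior point of it. *)

Definition branch (R : realType) (lu : R) (b : bool) (x : R) : R :=
  if b then lu * (1 - x) else lu * x.

(** The image of 1/2 under the composition of the inverse branches read along
    the code; it is the centre of the u-bridge. *)
Fixpoint bridge_centre (R : realType) (lu : R) (w : seq bool) : R :=
  if w is b :: w' then
    let c := lu^-1 * bridge_centre R lu w' in if b then 1 - c else c
  else 1 / 2.

Definition bridge_radius (R : realType) (lu : R) (w : seq bool) : R :=
  lu ^- size w / 2.

Arguments bridge_centre {R} lu w.
Arguments bridge_radius {R} lu w.
Arguments branch {R} lu b x.

Lemma bridge_radius_gt0 (R : realType) (lu : R) (w : seq bool) :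
  0 < lu -> 0 < bridge_radius lu w.
Proof. by move=> lu0; rewrite divr_gt0 // invr_gt0 exprn_gt0. Qed.

Lemma bridge_radius_cons (R : realType) (lu : R) (b : bool) (w : seq bool) :
  bridge_radius lu (b :: w) = lu^-1 * bridge_radius lu w.
Proof. by rewrite /bridge_radius /= exprS invfM mulrA. Qed.

(** This is what makes a point near [bridge_centre lu (b :: w)] lie in the
    strip V_b: its image under the branch b must not leave [0,1]. *)
Lemma bridge_centre_radius (R : realType) (lu : R) (w : seq bool) : 1 < lu ->
  bridge_radius lu w <= bridge_centre lu w <= 1 - bridge_radius lu w.
Proof.
move=> lu1; have lu0 : 0 < lu by lra.
have i0 : 0 < lu^-1 by rewrite invr_gt0.
have i1 : lu^-1 < 1 by rewrite invf_lt1.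
elim: w => [|b w /andP[lo hi]]; first by rewrite /bridge_radius /= invr1; lra.
rewrite bridge_radius_cons /=.
have r0 := bridge_radius_gt0 R lu w lu0.
by case: b; nra.
Qed.

Lemma branch_centre (R : realType) (lu : R) (b : bool) (w : seq bool) :
  lu != 0 -> branch lu b (bridge_centre lu (b :: w)) = bridge_centre lu w.
Proof. by move=> lu0; case: b; rewrite /branch /= ?subKr mulVKf. Qed.

Lemma branch_dist_centre (R : realType) (lu : R) (b : bool) (w : seq bool)
    (x : R) : 0 < lu ->
  (`|branch lu b x - bridge_centre lu w| <= bridge_radius lu w) =
  (`|x - bridge_centre lu (b :: w)| <= bridge_radius lu (b :: w)).
Proof.
move=> lu0; rewrite bridge_radius_cons [RHS]ler_pdivlMl //.
suff -> : `|branch lu b x - bridge_centre lu w| =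
    lu * `|x - bridge_centre lu (b :: w)| by [].
rewrite -(branch_centre R lu b w) ?gt_eqF // /branch.
case: b; rewrite -mulrBr normrM gtr0_norm //.
by rewrite distrC; congr (_ * `|_|); lra.
Qed.

Lemma V_near_centre (R : realType) (lu : R) (b : bool) (w : seq bool) (x : R) :
  1 < lu -> `|x - bridge_centre lu (b :: w)| <= bridge_radius lu (b :: w) ->
  V lu b x.
Proof.
move=> lu1; have lu0 : 0 < lu by lra.
have i0 : 0 < lu^-1 by rewrite invr_gt0.
have := bridge_centre_radius R lu w lu1.
rewrite bridge_radius_cons ler_distl => /andP[lo hi].
by case: b => /= /andP[? ?]; rewrite in_itv /=; nra.
Qed.

Lemma V_unit (R : realType) (lu : R) (b : bool) (x : R) :
  1 < lu -> V lu b x -> x \in `[0, 1].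
Proof.
move=> lu1; have i1 : lu^-1 < 1 by rewrite invf_lt1 //; lra.
by case: b => /=; rewrite !in_itv /=; lra.
Qed.

Lemma branch_unit (R : realType) (lu : R) (b : bool) (x : R) :
  0 < lu -> V lu b x -> branch lu b x \in `[0, 1].
Proof.
move=> lu0; have luV : lu * lu^-1 = 1 by rewrite divff ?gt_eqF.
by case: b; rewrite /branch /= !in_itv /=; nra.
Qed.

Lemma zeta_unit (R : realType) (lcs0 lcs1 : R) (b : bool) (z : R) :
  0 < lcs0 < 1 -> 0 < lcs1 < 1 -> z \in `[0, 1] ->
  zeta lcs0 lcs1 b z \in `[0, 1].
Proof. by case: b; rewrite /zeta !in_itv /=; nra. Qed.

Lemma blender_horseshoe_step (R : realType) (lss lcs0 lcs1 lu : R)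
    (f : R * R * R -> R * R * R) (b : bool) (x y z : R) :
  blender_constants lss lcs0 lcs1 lu ->
  blender_horseshoe_map lss lcs0 lcs1 lu f ->
  y \in `[0, 1] -> z \in `[0, 1] -> V lu b x ->
  exists2 y', y' \in `[0, 1] &
    f (x, y, z) = (branch lu b x, y', zeta lcs0 lcs1 b z).
Proof.
move=> [[lss0 _ _ _] [ltss lt0 _ _ _] lu2 _] hf hy hz hV.
have hx : x \in `[0, 1] by apply: V_unit hV; lra.
have [hf0 hf1] := hf _ _ _ hx hy hz; move: hy; rewrite in_itv /= => hy.
case: b hV => hV.
- by exists (1 - lss * y); [rewrite in_itv /=; nra | exact: hf1].
- by exists (lss * y); [rewrite in_itv /=; nra | exact: hf0].
Qed.

(** Stated for an arbitrary starting height (y, z), since the induction on the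
    code moves the base point (0, 0) of the definition of u-bridges. *)
Lemma itinerary_near_centre (R : realType) (lss lcs0 lcs1 lu : R)
    (f : R * R * R -> R * R * R) (w : seq bool) (x y z : R) :
  blender_constants lss lcs0 lcs1 lu ->
  blender_horseshoe_map lss lcs0 lcs1 lu f ->
  x \in `[0, 1] -> y \in `[0, 1] -> z \in `[0, 1] ->
  (forall i, (i < size w)%N -> V lu (nth false w i) (iter i f (x, y, z)).1.1) <->
  `|x - bridge_centre lu w| <= bridge_radius lu w.
Proof.
move=> hc hf; have [[_ ? ? ?] [_ ? ? ? _] ? _] := hc.
elim: w x y z => [|b w IHw] x y z hx hy hz.
  split=> // _; move: hx.
  by rewrite /bridge_radius /= invr1 ler_distl in_itv /=; lra.
(* Once x is in V_b, the first step reduces the itinerary b :: w to w. *)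
have tail : V lu b x ->
    (forall i, (i < size w)%N ->
       V lu (nth false w i) (iter i.+1 f (x, y, z)).1.1) <->
    `|x - bridge_centre lu (b :: w)| <= bridge_radius lu (b :: w).
  move=> hV; have [y' hy' fE] := blender_horseshoe_step R _ _ _ _ f _ _ _ _ hc hf hy hz hV.
  rewrite -branch_dist_centre; last by lra.
  have hz' : zeta lcs0 lcs1 b z \in `[0, 1] by apply: zeta_unit => //; lra.
  have hbx : branch lu b x \in `[0, 1] by apply: branch_unit hV; lra.
  rewrite -(IHw _ _ _ hbx hy' hz').
  by split=> h i /h; rewrite iterSr fE.
split=> [h|h].
- by apply/tail => [|i iw]; [exact: (h 0%N) | exact: (h i.+1)].
- have hV : V lu b x by apply: V_near_centre h; lra.
  by case=> [//|i]; apply: (proj2 (tail hV) h).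
Qed.

Lemma ubridgeE (R : realType) (lss lcs0 lcs1 lu : R)
    (f : R * R * R -> R * R * R) (w : seq bool) :
  blender_constants lss lcs0 lcs1 lu ->
  blender_horseshoe_map lss lcs0 lcs1 lu f ->
  ubridge lu f w =
    `[bridge_centre lu w - bridge_radius lu w,
      bridge_centre lu w + bridge_radius lu w]%classic.
Proof.
move=> hc hf; have [_ _ lu2 _] := hc.
have unit0 : 0 \in `[0, 1 : R] by rewrite in_itv /=; lra.
have itinE x hx :=
  itinerary_near_centre R _ _ _ _ f w x 0 0 hc hf hx unit0 unit0.
apply/seteqP; split=> x /=.
- by move=> [hx /(itinE x hx)]; rewrite in_itv /= ler_distl.
- rewrite in_itv /= => h.
  have hx : x \in `[0, 1].
    have := bridge_centre_radius R lu w; rewrite in_itv /=; lra.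
  by split=> //; apply/(itinE x hx); rewrite ler_distl.
Qed.

Lemma iter_bridge_centre (R : realType) (lss lcs0 lcs1 lu : R)
    (f : R * R * R -> R * R * R) (w : seq bool) (y z : R) :
  blender_constants lss lcs0 lcs1 lu ->
  blender_horseshoe_map lss lcs0 lcs1 lu f ->
  y \in `[0, 1] -> z \in `[0, 1] ->
  pihat (iter (size w) f (bridge_centre lu w, y, z)) =
    (1 / 2, zeta_word lcs0 lcs1 w z).
Proof.
move=> hc hf; have [[_ ? ? ?] [_ ? ? ? _] ? _] := hc.
elim: w y z => [//|b w IHw] y z hy hz.
have hV : V lu b (bridge_centre lu (b :: w)).
  apply: (V_near_centre R lu b w); first by lra.
  by rewrite subrr normr0 ltW // bridge_radius_gt0.
have [y' hy' fE] := blender_horseshoe_step R _ _ _ _ f _ _ _ _ hc hf hy hz hV.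
rewrite [size _]/= iterSr fE branch_centre ?gt_eqF // IHw //.
by apply: zeta_unit => //; lra.
Qed.

Lemma centre_itv (R : realType) (a r : R) :
  0 <= r -> centre `[a - r, a + r]%classic = a.
Proof.
move=> r0; have ar : a - r <= a + r by lra.
by rewrite /centre inf_itv ?bnd_simp // sup_itv ?bnd_simp //; lra.
Qed.

Lemma cs_interval_itv (R : realType) (a2 a b : R) : 0 < a2 ->
  cs_interval a2 `[a, b]%classic = `[a2^-1 * a, a2^-1 * b]%classic.
Proof.
move=> a20; have i0 : 0 < a2^-1 by rewrite invr_gt0.
apply/seteqP; split=> x /=.
- by move=> [p + <-]; rewrite /= !in_itv /= !ler_pM2l.
- rewrite in_itv /= => h; exists (a2 * x); last by rewrite mulKf ?gt_eqF.
  by move: h; rewrite /= in_itv /= ler_pdivrMl // ler_pdivlMl.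
Qed.

Theorem proposition2p3 (R : realType) (lss lcs0 lcs1 lu a2 : R)
  (hconst : blender_constants lss lcs0 lcs1 lu) (ha2 : 0 < a2)
  (f : R * R * R -> R * R * R)
  (hf : blender_horseshoe_map lss lcs0 lcs1 lu f)
  (n0 : nat) (wt w : nat -> seq bool)
  (hwt0 : size (wt 0%N) = n0)
  (hB0 : ubridge lu f (wt 0%N) `<=` `]0, a2[%classic)
  (hw : forall k : nat, (1 <= k)%N ->
     maximal_sub_bridge_codes lu f (wt k.-1) (wt k) (w k))
  (L : nat) (hL : (0 < L)%N)
  (wbar : nat -> seq bool)
  (hwbar_size : forall k : nat, (1 <= k)%N ->
     size (wbar k) = (n0 + k + L * k)%N)
  (hwbar_ext : forall k : nat, (1 <= k)%N -> prefix (w k) (wbar k))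
  (hwbar_sub : forall k : nat, (1 <= k)%N ->
     ubridge lu f (wbar k) `<=` ubridge lu f (w k))
  (what u v gam : nat -> seq bool) (m nhat : nat -> nat) (N0 N1 : nat)
  (hwhat_sub : forall k : nat, (1 <= k)%N ->
     ubridge lu f (what k) `<=` ubridge lu f (wbar k))
  (hnhat : forall k : nat, (1 <= k)%N -> nhat k = size (what k))
  (hN0 : (0 < N0)%N) (hN1 : (0 < N1)%N)
  (h1 : forall k : nat, (1 <= k)%N ->
     [/\ what k = wbar k ++ v k ++ gam k,
         size (gam k) = m k,
         (0 < m k <= N0 + N1 * k)%N &
         v k = u k \/ exists alpha : bool, v k = rcons (u k) alpha])
  (h2 : forall k : nat, (1 <= k)%N ->
     cs_interval a2 (ubridge lu f (wbar k.+1))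
       (zeta_word lcs0 lcs1 (what k) (1 / 2)) /\
     cs_interval a2 (ubridge lu f (what k.+1)) `<=`
       cs_interval a2 (ubridge lu f (wbar k.+1))) :
  forall k : nat, (1 <= k)%N ->
    exists t : R,
      phi_iter_eq f (nhat k) (centre (ubridge lu f (what k))) (1 / 2)
        ((1 / 2, centre (cs_interval a2 (ubridge lu f (what k.+1))))
           - (0, a2^-1 * t)) /\
      `|t| < lu ^- (n0 + k.+1 + L * k.+1).
Proof.
move=> k k1; have [_ _ lu2 _] := hconst.
have lu0 : 0 < lu by lra.
have bridgeE s := ubridgeE R _ _ _ _ f s hconst hf.
have centreE s : centre (ubridge lu f s) = bridge_centre lu s.
  by rewrite bridgeE centre_itv // ltW // bridge_radius_gt0.
have csE s : centre (cs_interval a2 (ubridge lu f s)) =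
    a2^-1 * bridge_centre lu s.
  rewrite bridgeE cs_interval_itv // mulrBr mulrDr centre_itv //.
  by rewrite mulr_ge0 ?invr_ge0 ?ltW // bridge_radius_gt0.
pose c := bridge_centre lu (what k.+1); pose r := bridge_radius lu (what k.+1).
pose zk := zeta_word lcs0 lcs1 (what k) (1 / 2).
exists (c - a2 * zk); split.
  move=> y hy; rewrite hnhat // centreE csE.
  rewrite (iter_bridge_centre _ _ _ _ _ _ _ _ _ hconst hf) //; last first.
    by rewrite in_itv /=; lra.
  apply/eqP; rewrite xpair_eqE /= subr0 eqxx /= -/c -/zk.
  by rewrite mulrBr mulKf ?(gt_eqF ha2) // subKr.
have r0 : 0 < r by exact: bridge_radius_gt0.
have lenE : lu ^- (n0 + k.+1 + L * k.+1) = 2 * bridge_radius lu (wbar k.+1).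
  by rewrite /bridge_radius hwbar_size //; lra.
have := (h2 k k1).1; rewrite -/zk => -[p + pE].
have -> : a2 * zk = p by rewrite -pE mulVKf ?gt_eqF.
(* Both endpoints of the interval of radius r around c are in the larger
   u-bridge, so c stays at distance r > 0 from its boundary. *)
have sub := hwhat_sub k.+1 isT; rewrite !bridgeE in sub *.
have := sub (c - r); have := sub (c + r).
rewrite lenE /= !in_itv /= -/c -/r ltr_norml; lra.
Qed.
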